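(* Let $r$ and $d$ be fixed positive integers with $r<d$, and let $S_t$ denote the size (number of vertices) of the largest $r$-ary subtree of a random $d$-ary recursive tree $\mathcal{T}_t$ at time $t$. Let $$\delta = 1 - \frac{d-r}{e\,d^{2d}\log\left(11\, d \log d\right)}.$$ Then eventually (for large $t$) $S_t<t^{\delta}$.
   Context: All logarithms are natural and $e$ is the base of the natural logarithm. Random $d$-ary recursive tree process: at time $0$ the tree $\mathcal{T}_0$ consists of exactly one vertex, the root. In the first step the root gives birth to $d$ offspring. In each subsequent step a vertex with no offspring is picked uniformly at random (given the past) and given exactly $d$ newly created offspring. $\mathcal{T}_t$ denotes the tree after $t$ steps. An $r$-ary subtree is a connected subgraph (subtree) of the rooted tree in which every vertex has at most $r$ offspring. A sequence of events $\{A_k, k\in\mathbb{N}\}$ occurs eventually (for large $k$) if there exists an almost surely finite random variable $N$ such that $A_k$ occurs for all $k\ge N$. *)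

(* Defs.v *)
From HB Require Import structures.
From mathcomp Require Import all_boot all_order all_algebra.
From mathcomp Require Import finmap.
From mathcomp Require Import all_classical all_reals all_analysis.
From mathcomp Require Import measurable_realfun.

Set Implicit Arguments.
Unset Strict Implicit.
Unset Printing Implicit Defensive.

Import Order.TTheory GRing.Theory Num.Theory.

Local Open Scope classical_set_scope.
Local Open Scope ring_scope.

(* Ulam-Harris addresses: [::] is the root, and the offspring of v in a d-ary
   tree are the vertices rcons v i with i < d. *)
Definition vertex (d : nat) : choiceType := seq 'I_d.

Definition tree (d : nat) := {fset vertex d}.

Definition root_tree (d : nat) : tree d := [fset ([::] : vertex d)]%fset.

Definition offspring (d : nat) (tau : tree d) (v : vertex d) : {set 'I_d} :=
  [set i | (rcons v i : vertex d) \in tau]%SET.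

Definition leaves (d : nat) (tau : tree d) : {fset vertex d} :=
  [fset v in tau | #|offspring tau v| == 0%N]%fset.

Definition give_birth (d : nat) (tau : tree d) (v : vertex d) : tree d :=
  (tau `|` [fset (rcons v i : vertex d) | i in 'I_d])%fset.

Definition tree_edge (d : nat) : rel (vertex d) := fun u v =>
  [exists i, v == rcons u i] || [exists i, u == rcons v i].

(* A connected subgraph of a tree is determined by its vertex set, as it has to
   contain every edge of the tree between two of its vertices; subtrees are
   therefore represented by vertex sets. A subtree need not contain [::]. *)
Definition connected_vertices (d : nat) (U : {fset vertex d}) : bool :=
  [forall u : U, forall v : U,
     connect (fun x y : U => tree_edge (val x) (val y)) u v].

Definition is_rary_subtree (d r : nat) (tau : tree d) (U : {fset vertex d}) : bool :=
  [&& (U `<=` tau)%fset, connected_vertices U &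
      [forall u : U, #|offspring U (val u)| <= r]%N].

Definition largest_rary_subtree_size (d r : nat) (tau : tree d) : nat :=
  \max_(U <- fpowerset tau | is_rary_subtree r tau U) #|` U|.

Section Process.
Context (R : realType) (disp : measure_display) (Omega : measurableType disp).
Variable P : probability Omega R.

(* chosen t is the vertex that gives birth in step t.+1. In chosen_uniform, h is a
   possible history of the tree up to time t. At t = 0 the root is the only
   vertex without offspring, so that the first step follows the general rule. *)
Record recursive_tree_process (d : nat) (chosen : nat -> Omega -> vertex d)
    (T : nat -> Omega -> tree d) : Prop := {
  process_start : forall w, T 0%N w = root_tree d ;
  process_step : forall t w, T t.+1 w = give_birth (T t w) (chosen t w) ;
  chosen_leaf : forall t w, chosen t w \in leaves (T t w) ;
  chosen_measurable : forall t v, measurable [set w | chosen t w = v] ;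
  chosen_uniform : forall t (h : nat -> tree d) v, v \in leaves (h t) ->
    let past := [set w | forall s, (s <= t)%N -> T s w = h s] in
    P (past `&` [set w | chosen t w = v]) =
      ((#|` leaves (h t)|%:R^-1 : R)%:E * P past)%E }.

Definition occurs_eventually (A : nat -> set Omega) : Prop :=
  exists N : {mfun Omega >-> \bar R},
    {ae P, forall w, N w \is a fin_num} /\
    forall w k, (N w <= (k%:R : R)%:E)%E -> A k w.

End Process.

Definition delta (R : realType) (d r : nat) : R :=
  1 - (d%:R - r%:R) /
      (expR 1 * d%:R ^+ (2 * d) * ln (11%:R * d%:R * ln d%:R)).

(* Main.v *)
Require Import Defs.
From HB Require Import structures.
From mathcomp Require Import all_boot all_order all_algebra.
From mathcomp Require Import finmap.
From mathcomp Require Import all_classical all_reals all_analysis.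
From mathcomp Require Import measurable_realfun.
From mathcomp Require Import zify ring lra.

Import Order.TTheory GRing.Theory Num.Theory.

Local Open Scope classical_set_scope.
Local Open Scope ring_scope.

Set Implicit Arguments.
Unset Strict Implicit.
Unset Printing Implicit Defensive.

(** The proof bounds one high moment of the size of the largest r-ary subtree.
    Since that size is nondecreasing in r, only r = d - 1 matters; put
    s = d - 1 and let W be the size of the largest s-ary subtree.

    Deterministic recursion.  Let T_i be the subtree hanging from the i-th
    child of the root.  An s-ary subtree through the root misses some child
    i0, so W(T) <= 1 + max over i0 of the sum of W(T_i), i <> i0
    ([largest_rary_subtree_size_branches]).

    Raising to a power.  Let x_i be the number of leaves of T_i and x_A the
    sum of the x_i with i <> i0.  Convexity of the power q+1, with weights
    proportional to the x_i, gives
      (1 + sum W(T_i))^(q+1) <= (1 + x_A)^q (1 + sum W(T_i)^(q+1) / x_i^q)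
    ([power_sum_le]).  The factors separate as needed: given the sizes, T_i
    is again a random recursive tree, so a bound E[W^(q+1)] <= C (leaves)^q for
    smaller trees can be inserted under the expectation
    ([expect_profile_branch_le]), leaving only E[(1 + x_A)^q].

    The urn.  The numbers x_A and x_(i0) are the contents of a Polya urn that
    starts from s and 1 and gains s at each step.  Its rising factorial moments
    are explicit ([expect_rising]): E[(x_A)^q] is about kappa (leaves)^q with
    kappa = prod_(1 <= j <= q) js/(js+1), and kappa^s <= 1/(q+1) by Bernoulli.
    The maximum over i0 costs a factor d and the sum over i another d, so the
    induction closes as soon as d^2 kappa < 1, which holds for q = d^(2s)
    ([urn_rate_lt1]).  Hence E[W(T_t)^(q+1)] = O(t^q) ([moment_bound]).

    Conclusion.  The exponent q/(q+1) = 1 - 1/(d^(2d-2)+1) is smaller than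
    delta ([moment_exponent_lt_delta]), so by Markov's inequality the events
    W(T_(2^(k+1))) >= 2^(k delta) have summable probabilities; by
    Borel-Cantelli only finitely many of them occur, and monotonicity of W
    in t fills the gaps between powers of 2. *)

(** * Branches and leaves of a tree *)

Section Trees.
Variables (d : nat) (d_gt0 : (0 < d)%N).
Implicit Types (tau : tree d) (u v : vertex d) (i j : 'I_d).

Definition branch tau i : tree d :=
  [fset (behead v : vertex d) | v in tau & ohead v == Some i]%fset.

Lemma in_branch tau i v : (v \in branch tau i) = ((i :: v : vertex d) \in tau).
Proof.
apply/imfsetP/idP => [[[|j u] /=]|h]; rewrite ?inE /= ?andbF //.
  by case/andP => h /eqP[<-] ->.
by exists (i :: v) => //; rewrite inE /= h eqxx.
Qed.

Lemma in_give_birth tau v u :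
  (u \in give_birth tau v) = (u \in tau) || [exists i, u == rcons v i].
Proof.
rewrite in_fsetU; congr (_ || _).
apply/imfsetP/existsP => [[i _ ->]|[i /eqP ->]]; by exists i.
Qed.

Lemma in_leaves tau v :
  (v \in leaves tau) = (v \in tau) && [forall i, (rcons v i : vertex d) \notin tau].
Proof.
rewrite !inE /=; congr (_ && _); rewrite cards_eq0.
apply/eqP/forallP => [h i|h].
  by have := finset.in_set0 i; rewrite -h inE => ->.
by apply/setP => i; rewrite !inE; apply/negbTE/h.
Qed.

Lemma mem_leaves_branch tau i v :
  (v \in leaves (branch tau i)) = ((i :: v : vertex d) \in leaves tau).
Proof.
rewrite !in_leaves in_branch; congr (_ && _); apply: eq_forallb => j.
by rewrite in_branch.
Qed.

(** Every tree grown from the root contains the parent of each of its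
    vertices; arbitrary finite sets of addresses need not, and then a
    birth can change the number of leaves by another amount than d - 1. *)
Definition prefix_closed tau := forall v i, (rcons v i : vertex d) \in tau -> v \in tau.

Lemma prefix_closed_give_birth tau v : v \in tau ->
  prefix_closed tau -> prefix_closed (give_birth tau v).
Proof.
move=> hv ct u i; rewrite !in_give_birth => /orP[/ct ->//|/existsP[j]].
by rewrite eqseq_rcons => /andP[/eqP -> _]; rewrite hv.
Qed.

Lemma leaves_give_birth tau v : prefix_closed tau -> v \in leaves tau ->
  leaves (give_birth tau v) =
    ((leaves tau `\ v) `|` [fset (rcons v i : vertex d) | i in 'I_d])%fset.
Proof.
move=> ct; rewrite in_leaves => /andP[vt /forallP vl].
apply/fsetP => u; rewrite in_fsetU in_fsetD1 !in_leaves in_give_birth.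
have -> : (u \in [fset (rcons v i : vertex d) | i in 'I_d]%fset) = [exists i, u == rcons v i].
  apply/imfsetP/existsP => [[i _ ->]|[i /eqP ->]]; by exists i.
(* Is u a newborn child of v, or an older vertex? *)
have [/existsP[i /eqP ->]|/negbTE nu] /= := boolP [exists i, u == rcons v i].
  rewrite !orbT /=; apply/forallP => j; rewrite in_give_birth negb_or.
  apply/andP; split; first by apply/negP => /ct; apply/negP.
  apply/existsPn => k; apply/negP => /eqP /(congr1 size).
  by rewrite !size_rcons => /eqP; lia.
rewrite !orbF; case: (boolP (u \in tau)) => ut /=; last by rewrite andbF.
apply/forallP/andP => [h|[uv /forallP h] i].
  split; last by apply/forallP => i; apply: contra (h i); rewrite in_give_birth => ->.
  apply/eqP => e; subst u.
  pose i := Ordinal d_gt0.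
  by have := h i; rewrite in_give_birth negb_or => /andP[_ /existsPn/(_ i)/eqP].
rewrite in_give_birth negb_or h /=; apply/existsPn => j.
by apply: contra uv; rewrite eqseq_rcons => /andP[].
Qed.

(** The chosen leaf is replaced by its d children.  Prefix closure ensures
    that a child of v has no stray descendants already in the set. *)
Lemma card_leaves_give_birth tau v : prefix_closed tau -> v \in leaves tau ->
  #|` leaves (give_birth tau v)| = (#|` leaves tau| + d.-1)%N.
Proof.
move=> ct vl; rewrite leaves_give_birth //.
have /andP[vt /forallP vl'] : (v \in tau) && [forall i, (rcons v i : vertex d) \notin tau].
  by rewrite -in_leaves.
rewrite cardfsU; set K := [fset _ | _ in _]%fset.
have -> : #|` K| = d.
  rewrite card_imfset /=; last by move=> i j /rcons_inj[].
  by rewrite -cardE card_ord.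
have -> : ((leaves tau `\ v) `&` K = fset0)%fset.
  apply/eqP; rewrite -fsubset0; apply/fsubsetP => u; rewrite in_fsetI in_fsetD1 in_leaves.
  by case/andP=> /and3P[_ ut _] /imfsetP[i _ ui]; have := vl' i; rewrite -ui ut.
rewrite cardfs0 subn0 (cardfsD1 v (leaves tau)) vl; lia.
Qed.

Lemma leaves_branches tau : [::] \notin leaves tau ->
  perm_eq (leaves tau)
    [seq (i :: v : vertex d) | i <- enum 'I_d, v <- leaves (branch tau i)].
Proof.
move=> nr; apply: uniq_perm; first exact: fset_uniq.
  apply: allpairs_uniq_dep => [|i _|[i u] [j v] _ _ /= [-> ->]//].
    exact: enum_uniq.
  exact: fset_uniq.
case=> [|i v].
  by rewrite (negbTE nr); apply/esym/negbTE/negP => /allpairsPdep[i [v []]].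
rewrite -mem_leaves_branch; apply/idP/allpairsPdep => [h|[j [u [_ h [-> ->]]]]//].
by exists i, v; rewrite mem_enum.
Qed.

Lemma sum_leaves_branches (V : nmodType) tau (F : vertex d -> V) :
  [::] \notin leaves tau ->
  \sum_(v <- leaves tau) F v =
  \sum_i \sum_(v <- leaves (branch tau i)) F (i :: v).
Proof.
move=> /leaves_branches/(perm_big _) ->.
by rewrite big_allpairs_dep big_enum.
Qed.

Lemma card_leaves_branches tau : [::] \notin leaves tau ->
  #|` leaves tau| = (\sum_i #|` leaves (branch tau i)|)%N.
Proof.
move=> /(sum_leaves_branches (fun=> 1%N)); rewrite sum1_size => ->.
by apply: eq_bigr => i _; rewrite sum1_size.
Qed.

Lemma branch_give_birth tau i j v :
  branch (give_birth tau (i :: v)) j =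
  if j == i then give_birth (branch tau i) v else branch tau j.
Proof.
apply/fsetP => u; rewrite in_branch in_give_birth.
have -> : [exists k, (j :: u : vertex d) == rcons (i :: v) k] =
          (j == i) && [exists k, u == rcons v k].
  apply/existsP/andP => [[k /=]|[/eqP -> /existsP[k /eqP ->]]]; last by exists k.
  by rewrite eqseq_cons => /andP[-> h]; split=> //; apply/existsP; exists k.
by case: eqP => [->|_]; rewrite ?in_give_birth ?in_branch ?orbF.
Qed.

Lemma prefix_closed_branch tau i : prefix_closed tau -> prefix_closed (branch tau i).
Proof. by move=> ct v j; rewrite !in_branch => h; apply: (ct (i :: v) j). Qed.

Lemma root_notin_leaves_give_birth tau v : [::] \notin leaves tau ->
  v \in tau -> [::] \notin leaves (give_birth tau v).
Proof.
rewrite !in_leaves !negb_and in_give_birth => h vt.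
case/orP: h => [h|/forallPn[i /negPn h]]; last first.
  by apply/orP; right; apply/forallPn; exists i; rewrite negbK in_give_birth h.
apply/orP; left; rewrite negb_or h /=; apply/existsPn => i.
by apply/eqP => /(congr1 size); rewrite size_rcons.
Qed.
End Trees.

(** * A recursion for the largest r-ary subtree *)

(** Reachability as an induction principle: it is used both with a property
    of vertices and with reachability of images under a map. *)
Lemma connect_invariant (V : finType) (e : rel V) (P : V -> Prop) x y :
  (forall a b, e a b -> P a -> P b) -> connect e x y -> P x -> P y.
Proof.
move=> h /connectP[p + ->]; elim: p x => [//|z p ih] x /= /andP[xz pz] Px.
by apply: ih => //; apply: h Px.
Qed.

Section Largest.
Variables (d : nat).
Implicit Types (tau U : tree d) (u v : vertex d) (i j : 'I_d).

Lemma tree_edge_cons i u v :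
  tree_edge (i :: u : vertex d) (i :: v) = tree_edge u v.
Proof.
rewrite /tree_edge; congr (_ || _); apply: eq_existsb => j;
  by rewrite rcons_cons eqseq_cons eqxx.
Qed.

(** An edge either stays inside the branch of one child of the root or joins
    the root to one of its children. *)
Lemma tree_edge_ohead u v : tree_edge u v ->
  [\/ ohead u = ohead v, u = [::] /\ exists i, v = [:: i]
    | v = [::] /\ exists i, u = [:: i]].
Proof.
case/orP => /existsP[j /eqP ->].
- case: u => [|i u] /=; last by constructor 1.
  by constructor 2; split=> //; exists j.
- case: v => [|i v] /=; last by constructor 1.
  by constructor 3; split=> //; exists j.
Qed.

(** Collapse everything outside branch i onto the root of that branch: the
    collapse sends each edge to an edge or to a single vertex, hence walks
    to walks.  When the root of the branch is not in U, no edge of U leaves the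
    branch, and any vertex of the branch can serve as the image. *)
Lemma connected_branch U i :
  connected_vertices U -> connected_vertices (branch U i).
Proof.
move=> /forallP cU; apply/forallP => u; apply/forallP => v.
have hU (w : branch U i) : (i :: val w : vertex d) \in U.
  by rewrite -in_branch; exact: valP.
pose pr (x : U) : branch U i :=
  insubd u (if ohead (val x) == Some i then behead (val x) else [::]).
have prE (w : branch U i) : pr [` hU w]%fset = w.
  by rewrite /pr /= eqxx valKd.
rewrite -(prE u) -(prE v).
have := forallP (cU [` hU u]%fset) [` hU v]%fset.
move/(@connect_invariant _ _ (fun z => connect (fun x y : branch U i =>
  tree_edge (val x) (val y)) (pr [` hU u]%fset) (pr z))); apply => //.
move=> {v} x y exy h; apply: connect_trans h _.
have prv (z : U) w : val z = (i :: w : vertex d) -> val (pr z) = w.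
  move=> zw; rewrite /pr zw eqxx /= val_insubd in_branch.
  by have := valP z; rewrite zw => ->.
have [oe|[x0 [j yj]]|[y0 [j xj]]] := tree_edge_ohead exy.
- case: (ohead (val x) =P Some i) => xi; last first.
    by rewrite /pr -oe; move/eqP/negbTE: xi => ->; exact: connect0.
  have [a ex] : exists a, val x = (i :: a : vertex d).
    by case: (val x) xi => [//|k a] [->]; exists a.
  have [b ey] : exists b, val y = (i :: b : vertex d).
    by move: xi; rewrite oe; case: (val y) => [//|k b] [->]; exists b.
  apply: connect1; rewrite (prv _ _ ex) (prv _ _ ey).
  by rewrite -(tree_edge_cons i) -ex -ey.
- case: (j =P i) => [ji|/eqP/negbTE ji].
    subst j; suff -> : pr x = pr y by exact: connect0.
    by rewrite /pr x0 yj eqxx.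
  suff -> : pr x = pr y by exact: connect0.
  by rewrite /pr x0 yj /= (inj_eq (@Some_inj _)) ji.
- case: (j =P i) => [ji|/eqP/negbTE ji].
    subst j; suff -> : pr x = pr y by exact: connect0.
    by rewrite /pr y0 xj eqxx.
  suff -> : pr x = pr y by exact: connect0.
  by rewrite /pr y0 xj /= (inj_eq (@Some_inj _)) ji.
Qed.

Lemma is_rary_subtree_branch r tau U i :
  is_rary_subtree r tau U -> is_rary_subtree r (branch tau i) (branch U i).
Proof.
move=> /and3P[/fsubsetP Utau cU /forallP rU]; apply/and3P; split.
- by apply/fsubsetP => v; rewrite !in_branch; exact: Utau.
- exact: connected_branch.
apply/forallP => u.
have hu : (i :: val u : vertex d) \in U by rewrite -in_branch; exact: valP.
rewrite (leq_trans _ (rU [` hu]%fset)) // subset_leq_card //.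
by apply/fintype.subsetP => j; rewrite !inE in_branch.
Qed.

Lemma card_rary_subtree r tau U :
  is_rary_subtree r tau U -> (#|` U| <= largest_rary_subtree_size r tau)%N.
Proof.
move=> h; rewrite /largest_rary_subtree_size.
have UP : U \in fpowerset tau by rewrite fpowersetE; case/and3P: h.
exact: (@leq_bigmax_seq _ (enum_fset (fpowerset tau)) (is_rary_subtree r tau)
  (fun V : {fset vertex d} => #|` V|) U UP h).
Qed.

Lemma card_branches U :
  #|` U| = (([::] \in U) + \sum_i #|` branch U i|)%N.
Proof.
rewrite (cardfsD1 ([::] : vertex d)); congr (_ + _)%N.
have p : perm_eq (U `\ ([::] : vertex d))%fset
    [seq (i :: v : vertex d) | i <- enum 'I_d, v <- branch U i].
  apply: uniq_perm; first exact: fset_uniq.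
    apply: allpairs_uniq_dep => [|i _|[i u] [j v] _ _ /= [-> ->]//].
      exact: enum_uniq.
    exact: fset_uniq.
  case=> [|i v]; rewrite !inE.
    by apply/esym/negbTE/negP => /allpairsPdep[i [v []]].
  rewrite -in_branch; apply/idP/allpairsPdep => [h|[j [u [_ h [-> ->]]]]//].
  by exists i, v; rewrite mem_enum.
rewrite (perm_size p) size_allpairs_dep sumnE big_map big_enum.
by [].
Qed.

(** If U contains the root, one of its d children is missing from U, and then
    connectedness leaves no vertex of U in that branch.  If U avoids the root, it
    lies inside a single branch i, and any i0 other than i will do; this
    is where a second child is needed. *)
Lemma largest_rary_subtree_size_branches tau : (1 < d)%N ->
  (largest_rary_subtree_size d.-1 tau <=
   \max_i0 (1 + \sum_(i | i != i0) largest_rary_subtree_size d.-1 (branch tau i)))%N.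
Proof.
move=> d_gt1; apply/bigmax_leqP_seq => U _ hU.
have br i := card_rary_subtree (is_rary_subtree_branch i hU).
have pick i0 : (#|` U| <= 1 + \sum_(i | i != i0)
    largest_rary_subtree_size d.-1 (branch tau i))%N ->
   (#|` U| <= \max_i0 (1 + \sum_(i | i != i0)
    largest_rary_subtree_size d.-1 (branch tau i)))%N.
  by move=> h; apply: leq_trans h (leq_bigmax _).
have [_ /forallP cU /forallP rU] := and3P hU.
case: (boolP (([::] : vertex d) \in U)) => rootU.
  have [i0 i0P] : exists i0, (([:: i0] : vertex d) \notin U).
    apply/existsP; apply: contraLR (rU [` rootU]%fset) => /existsPn h.
    rewrite -ltnNge /=; suff -> : offspring U [::] = [set: 'I_d]%SET.
      by rewrite cardsT card_ord; lia.
    by apply/setP => i; rewrite !inE; have := h i; rewrite negbK.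
  apply: (pick i0); rewrite card_branches rootU leq_add2l (bigD1 i0) //=.
  suff -> : branch U i0 = fset0 by rewrite cardfs0 add0n; apply: leq_sum.
  apply/eqP; rewrite -fsubset0; apply/fsubsetP => v; rewrite in_branch => vU.
  have := forallP (cU [` rootU]%fset) [` vU]%fset.
  move/(@connect_invariant _ _ (fun z => ohead (val z) <> Some i0)) => /=.
  move=> h; suff : Some i0 <> Some i0 by [].
  apply: h => // x y /tree_edge_ohead.
  case=> [->//|[_ [j yj]] _|[-> //]].
  rewrite yj => -[ji]; move: i0P; rewrite -ji -yj => /negP; apply; exact: valP.
have [->|/fset0Pn[[|i v] vU]] := eqVneq U fset0; first by rewrite cardfs0.
  by rewrite vU in rootU.
have [i0 i0i] : exists i0, i0 != i.
  apply/existsP; apply: contraLR d_gt1 => /existsPn h.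
  rewrite -leqNgt -[d]card_ord; apply/card_le1_eqP => a b _ _.
  by have := h a; have := h b; rewrite !negbK => /eqP -> /eqP ->.
apply: (pick i0); rewrite card_branches (negbTE rootU) add0n.
rewrite (bigD1 i) //= [X in (_ + X)%N]big1 ?addn0.
  apply: leq_trans (leq_addl _ _); rewrite (bigD1 i) 1?eq_sym //=.
  by apply: leq_trans (leq_addr _ _).
move=> j ji; apply/eqP; rewrite cardfs_eq0 -fsubset0.
apply/fsubsetP => w; rewrite in_branch => wU.
have := forallP (cU [` vU]%fset) [` wU]%fset.
move/(@connect_invariant _ _ (fun z => ohead (val z) = Some i)) => /= h.
suff [jj] : Some j = Some i by rewrite jj eqxx in ji.
apply: h => // x y /tree_edge_ohead.
case=> [->//|[xr _] _|[yr _] _].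
  by move: rootU; rewrite -xr => /negP; case; exact: valP.
by move: rootU; rewrite -yr => /negP; case; exact: valP.
Qed.

Lemma largest_rary_subtree_size_homo r r' tau tau' :
  (r <= r')%N -> (tau `<=` tau')%fset ->
  (largest_rary_subtree_size r tau <= largest_rary_subtree_size r' tau')%N.
Proof.
move=> rr' tt'; apply/bigmax_leqP_seq => U _ /and3P[Ut cU /forallP rU].
apply: card_rary_subtree; apply/and3P; split => //.
  exact: fsubset_trans tt'.
by apply/forallP => u; apply: leq_trans rr'.
Qed.

End Largest.

(** * The averaging operator of uniform growth *)

Section Growth.
Variables (R : realFieldType) (d : nat) (d_gt0 : (0 < d)%N).
Implicit Types (tau : tree d) (v : vertex d) (i j : 'I_d) (F G : tree d -> R).

(** One step of the growth, as an operator on functions of the tree. *)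
Definition average F tau : R :=
  #|` leaves tau|%:R^-1 * \sum_(v <- leaves tau) F (give_birth tau v).

(** The mean of F after n steps.  Being an iterate of a linear operator, it
    can be expanded at the first step ([expectS]) as well as at the last
    ([expectSr]). *)
Definition expect n F : tree d -> R := iter n average F.

Lemma expectS n F tau : expect n.+1 F tau = average (expect n F) tau.
Proof. by []. Qed.

Lemma expectSr n F : expect n.+1 F = expect n (average F).
Proof. by rewrite /expect iterSr. Qed.

Lemma expect_le (I : tree d -> Prop) n F G tau :
    (forall t v, I t -> v \in leaves t -> I (give_birth t v)) ->
    (forall t, I t -> F t <= G t) ->
  I tau -> expect n F tau <= expect n G tau.
Proof.
move=> Ib FG; elim: n tau => [|n ih] tau It; first exact: FG.
rewrite !expectS ler_wpM2l ?invr_ge0 //.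
by rewrite big_seq [leRHS]big_seq ler_sum // => v /(Ib _ _ It)/ih.
Qed.

Lemma expect_eq (I : tree d -> Prop) n F G tau :
    (forall t v, I t -> v \in leaves t -> I (give_birth t v)) ->
    (forall t, I t -> F t = G t) ->
  I tau -> expect n F tau = expect n G tau.
Proof.
move=> Ib FG It; apply/eqP; rewrite eq_le.
by rewrite !(@expect_le I) // => t /FG ->.
Qed.

Lemma expect_sum (J : finType) (P : pred J) n (F : J -> tree d -> R) tau :
  expect n (fun t => \sum_(j | P j) F j t) tau = \sum_(j | P j) expect n (F j) tau.
Proof.
elim: n tau => // n ih tau; rewrite expectS /average.
under eq_bigr do rewrite ih.
by rewrite exchange_big mulr_sumr.
Qed.

Lemma expectD n F G tau :
  expect n (fun t => F t + G t) tau = expect n F tau + expect n G tau.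
Proof.
elim: n tau => // n ih tau; rewrite expectS /average.
by under eq_bigr do rewrite ih; rewrite big_split mulrDr.
Qed.

Lemma expectZ n a F tau : expect n (fun t => a * F t) tau = a * expect n F tau.
Proof.
elim: n tau => // n ih tau; rewrite expectS /average.
by under eq_bigr do rewrite ih; rewrite -mulr_sumr mulrCA.
Qed.

(** The tree after the first step, from which the d branches grow. *)
Definition star := give_birth (root_tree d) [::].

Lemma leaves_root_tree : leaves (root_tree d) = root_tree d.
Proof.
apply/fsetP => v; rewrite in_leaves !in_fset1; case: eqP => //= ->.
by apply/forallP => i; rewrite in_fset1.
Qed.

Lemma prefix_closed_root_tree : prefix_closed (root_tree d).
Proof. by move=> [|j v] i; rewrite in_fset1. Qed.

Lemma prefix_closed_star : prefix_closed star.
Proof.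
by apply: prefix_closed_give_birth prefix_closed_root_tree; rewrite in_fset1.
Qed.

Lemma average_root F : average F (root_tree d) = F star.
Proof.
by rewrite /average leaves_root_tree big_seq_fset1 cardfs1 invr1 mul1r.
Qed.

Lemma branch_star i : branch star i = root_tree d.
Proof.
apply/fsetP => v; rewrite in_branch in_give_birth !in_fset1 /=.
apply/existsP/eqP => [[j /eqP[_ ->]//]|->]; by exists i.
Qed.

Lemma root_notin_leaves_star : [::] \notin leaves star.
Proof.
rewrite in_leaves negb_and; apply/orP; right; apply/forallPn.
exists (Ordinal d_gt0); rewrite negbK in_give_birth.
by apply/orP; right; apply/existsP; exists (Ordinal d_gt0).
Qed.

(** The number of leaves is deterministic: each step adds d - 1. *)
Lemma expect_card_leaves (h : nat -> R) n tau :
  prefix_closed tau -> (0 < #|` leaves tau|)%N ->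
  expect n (fun t => h #|` leaves t|) tau = h (#|` leaves tau| + n * d.-1)%N.
Proof.
elim: n tau => [|n ih] tau ct lt; first by rewrite /= addn0.
rewrite expectS /average.
rewrite (eq_big_seq (fun=> h (#|` leaves tau| + n.+1 * d.-1)%N)) => [|v vl].
  by rewrite big_const_seq count_predT iter_addr_0 -[X in _ * X]mulr_natl mulKf ?pnatr_eq0 -?lt0n.
rewrite ih ?card_leaves_give_birth //; last 2 first.
- by apply: prefix_closed_give_birth => //; move: vl; rewrite in_leaves => /andP[].
- by rewrite addn_gt0 lt.
by congr h; lia.
Qed.

(** The composition of the urn that the branches form: the next birth falls
    in branch i with probability proportional to [profile tau i]. *)
Definition profile tau : 'I_d -> nat := fun i => #|` leaves (branch tau i)|.

Definition bump_profile (x : 'I_d -> nat) j : 'I_d -> nat :=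
  fun i => if i == j then (x i + d.-1)%N else x i.

Definition branching tau :=
  [/\ prefix_closed tau, [::] \notin leaves tau & forall i, (0 < profile tau i)%N].

Lemma profile_give_birth tau j v : prefix_closed tau ->
  v \in leaves (branch tau j) ->
  profile (give_birth tau (j :: v)) = bump_profile (profile tau) j.
Proof.
move=> ct vl; apply/funext => i; rewrite /profile /bump_profile branch_give_birth.
case: eqP => [->|//]; rewrite card_leaves_give_birth //.
exact: prefix_closed_branch.
Qed.

Lemma branching_star : branching star.
Proof.
split; [exact: prefix_closed_star | exact: root_notin_leaves_star |].
by move=> i; rewrite /profile branch_star leaves_root_tree cardfs1.
Qed.

Lemma branching_give_birth tau v :
  branching tau -> v \in leaves tau -> branching (give_birth tau v).
Proof.
move=> [ct rt pt] vl.
have vt : v \in tau by move: vl; rewrite in_leaves => /andP[].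
split; [exact: prefix_closed_give_birth | exact: root_notin_leaves_give_birth |].
case: v vl {vt} => [|j v] vl; first by rewrite vl in rt.
move=> i; rewrite profile_give_birth ?mem_leaves_branch // /bump_profile.
by case: ifP => // _; rewrite addn_gt0 pt.
Qed.

Lemma card_leaves_profile tau : branching tau ->
  #|` leaves tau| = (\sum_i profile tau i)%N.
Proof. by case=> _ rt _; exact: card_leaves_branches. Qed.

Lemma average_branching F tau : branching tau ->
  average F tau = (\sum_i profile tau i)%N%:R^-1 *
    \sum_j \sum_(v <- leaves (branch tau j)) F (give_birth tau (j :: v)).
Proof.
move=> bt; rewrite -card_leaves_profile // /average sum_leaves_branches //.
by case: bt.
Qed.

(** A step outside branch i changes only the profile; a step inside it
    changes the profile in a way that does not depend on the leaf, and acts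
    on F by averaging.  So functions of the form psi(profile) F(branch i) are
    mapped to sums of two functions of the same form. *)
Lemma average_profile_branch (psi : ('I_d -> nat) -> R) F i tau :
  branching tau ->
  average (fun t => psi (profile t) * F (branch t i)) tau =
  (\sum_(j | j != i) (\sum_k profile tau k)%N%:R^-1 * (profile tau j)%:R *
     psi (bump_profile (profile tau) j)) * F (branch tau i) +
  (\sum_k profile tau k)%N%:R^-1 * (profile tau i)%:R *
     psi (bump_profile (profile tau) i) * average F (branch tau i).
Proof.
move=> bt; have [ct rt pt] := bt;
rewrite average_branching // [X in _ * X = _](bigD1 i) //= mulrDr addrC.
congr (_ + _).
  rewrite mulr_sumr mulr_suml; apply: eq_bigr => j ji.
  rewrite (eq_big_seq (fun=> psi (bump_profile (profile tau) j) * F (branch tau i))).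
    by rewrite big_const_seq count_predT iter_addr_0 -[X in _ * X = _]mulr_natl !mulrA.
  by move=> v vl; rewrite profile_give_birth // branch_give_birth eq_sym (negbTE ji).
rewrite (eq_big_seq (fun v => psi (bump_profile (profile tau) i) *
   F (give_birth (branch tau i) v))).
  rewrite -mulr_sumr /average -!mulrA; congr (_ * _).
  rewrite [RHS]mulrCA; congr (_ * _); rewrite mulVKf //.
  by rewrite pnatr_eq0 -lt0n; exact: pt.
by move=> v vl; rewrite profile_give_birth // branch_give_birth eqxx.
Qed.

(** Given the sizes of all branches, branch i is again a random recursive
    tree; so a comparison of means over recursive trees may be inserted
    under any nonnegative weight that depends on the sizes.  Expanding at the
    last step makes the induction immediate, because F and G are replaced by
    their averages, whose means are those of F and G one step later. *)
Lemma expect_profile_branch_le n (psi : ('I_d -> nat) -> R) F G i :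
    (forall m, (m <= n)%N -> expect m F (root_tree d) <= expect m G (root_tree d)) ->
    (forall x, 0 <= psi x) ->
  expect n (fun t => psi (profile t) * F (branch t i)) star <=
  expect n (fun t => psi (profile t) * G (branch t i)) star.
Proof.
elim: n psi F G => [|n ih] psi F G FG psi0.
  by rewrite /= !branch_star ler_wpM2l //; exact: (FG 0%N).
rewrite !expectSr.
rewrite !(@expect_eq branching n (average _) _ _ branching_give_birth
  (average_profile_branch _ _ _) branching_star).
rewrite !expectD lerD //.
  apply: (ih (fun x => \sum_(j | j != i) (\sum_k x k)%N%:R^-1 * (x j)%:R *
     psi (bump_profile x j))) => [m mn|x]; first exact/FG/leqW.
  by apply: sumr_ge0 => j _; rewrite !mulr_ge0 ?invr_ge0.
apply: (ih (fun x => (\sum_k x k)%N%:R^-1 * (x i)%:R * psi (bump_profile x i))).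
  by move=> m mn; rewrite -!expectSr; exact: FG.
by move=> x; rewrite !mulr_ge0 ?invr_ge0.
Qed.

End Growth.

(** * Power means and rising factorials *)

Section Inequalities.
Variable R : realFieldType.
Implicit Types (x y : R) (q : nat).

(** The tangent line of a^(q+1) at a = y, in a form free of division. *)
Lemma tangent_power q (a y : R) : 0 <= a -> 0 <= y ->
  q.+1%:R * y ^+ q * a <= a ^+ q.+1 + q%:R * y ^+ q.+1.
Proof.
move=> a0 y0; elim: q => [|q ih]; first by rewrite expr0 expr1 mul0r addr0 !mul1r.
have h : 0 <= q.+1%:R * y ^+ q * (y - a) ^+ 2
  by apply: mulr_ge0; [apply: mulr_ge0; rewrite ?exprn_ge0|exact: sqr_ge0].
have := ler_wpM2l a0 ih; rewrite -subr_ge0 => h'.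
rewrite -subr_ge0; apply: le_trans (addr_ge0 h h') _.
rewrite le_eqVlt; apply/orP; left; apply/eqP.
rewrite -!natr1 !exprS; ring.
Qed.

(** Jensen's inequality for the power q+1 with weights proportional to
    1 and the u j.  The proof adds up the tangent lines taken at the
    common ratio S / X of w j to u j; they add up to S^(q+1) / X^q. *)
Lemma power_sum_le (J : finType) (P : pred J) q (w u : J -> R) :
    (forall j, P j -> 0 <= w j) -> (forall j, P j -> 0 < u j) ->
  (1 + \sum_(j | P j) w j) ^+ q.+1 <=
  (1 + \sum_(j | P j) u j) ^+ q * (1 + \sum_(j | P j) w j ^+ q.+1 / u j ^+ q).
Proof.
move=> w0 u0; set S := 1 + _; set X := 1 + \sum_(j | P j) u j.
have X0 : 0 < X by rewrite ltr_wpDr // sumr_ge0 // => j /u0/ltW.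
have S0 : 0 <= S by rewrite addr_ge0 // sumr_ge0.
(* The optimal slope: at w = y u all the tangent inequalities are tight. *)
pose y := S / X; have y0 : 0 <= y by rewrite divr_ge0 // ltW.
have key (a b : R) : 0 <= a -> 0 < b ->
    q.+1%:R * y ^+ q * a - q%:R * y ^+ q.+1 * b <= a ^+ q.+1 / b ^+ q.
  move=> a0 b0; have bn : b != 0 by rewrite gt_eqF.
  have [c c0 ->] : exists2 c, 0 <= c & a = b * c.
    by exists (a / b); [rewrite divr_ge0 // ltW | rewrite mulrC divfK].
  have -> : (b * c) ^+ q.+1 / b ^+ q = b * c ^+ q.+1.
    by rewrite exprMn exprS; field; rewrite expf_neq0.
  rewrite lerBlDr; apply: le_trans (_ : b * (c ^+ q.+1 + q%:R * y ^+ q.+1) <= _).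
    by rewrite mulrCA ler_wpM2l ?(ltW b0) //; exact: tangent_power.
  by rewrite mulrDr [b * (q%:R * _)]mulrC.
have : q.+1%:R * y ^+ q * S - q%:R * y ^+ q.+1 * X <=
    1 + \sum_(j | P j) w j ^+ q.+1 / u j ^+ q.
  rewrite /S /X !mulrDr opprD addrACA lerD //.
    by have := key 1 1 ler01 ltr01; rewrite !expr1n divr1.
  rewrite !mulr_sumr -sumrB ler_sum // => j Pj.
  by apply: key; [exact: w0 | exact: u0].
move/(ler_wpM2l (exprn_ge0 q (ltW X0))); apply: le_trans.
rewrite le_eqVlt; apply/orP; left; apply/eqP.
have Xn : X != 0 by rewrite gt_eqF.
rewrite /y -natr1 !expr_div_n !exprS; field.
by rewrite expf_neq0.
Qed.

(** It replaces x^q because its mean in a Polya urn with increment s has a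
    closed form. *)
Definition rising q (s x : R) : R := \prod_(j < q) (x + j%:R * s).

Lemma rising_ge0 q s x : 0 <= s -> 0 <= x -> 0 <= rising q s x.
Proof. by move=> s0 x0; apply: prodr_ge0 => j _; rewrite addr_ge0 ?mulr_ge0. Qed.

Lemma rising_gt0 q s x : 0 <= s -> 0 < x -> 0 < rising q s x.
Proof. by move=> s0 x0; apply: prodr_gt0 => j _; rewrite ltr_wpDr ?mulr_ge0. Qed.

Lemma rising_shift q s x : x * rising q s (x + s) = (x + q%:R * s) * rising q s x.
Proof.
rewrite /rising; elim: q => [|q ih]; first by rewrite !big_ord0 mul0r addr0.
rewrite !big_ord_recr /= mulrA ih -natr1; ring.
Qed.

Lemma rising_le q s x : 0 <= s -> 0 <= x -> rising q s x <= (x + q%:R * s) ^+ q.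
Proof.
move=> s0 x0.
have -> : (x + q%:R * s) ^+ q = \prod_(j < q) (x + q%:R * s).
  by rewrite prodr_const card_ord.
apply: ler_prod => j _.
by rewrite addr_ge0 ?mulr_ge0 // lerD2l ler_wpM2r // ler_nat ltnW.
Qed.

(** The first factor of the rising product is x rather than 1 + x; every
    other one is at least 1 + x.  Hence the loss (1 + x) / x, which is at most
    d / (d - 1) where the lemma is used. *)
Lemma power_le_rising q s x : (0 < q)%N -> 1 <= s -> 0 <= x ->
  x * (1 + x) ^+ q <= (1 + x) * rising q s x.
Proof.
case: q => // q _ s1 x0; rewrite /rising big_ord_recl mul0r addr0 exprS.
rewrite mulrCA ler_wpM2l ?addr_ge0 // ler_wpM2l //.
have -> : (1 + x) ^+ q = \prod_(j < q) (1 + x) by rewrite prodr_const card_ord.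
apply: ler_prod => j _.
rewrite addr_ge0 //= addrC lerD2l /bump /= add1n.
by rewrite (le_trans s1) // ler_peMl ?(le_trans ler01) // ler1n.
Qed.

Lemma one_plus_mul_le_exp n x : -1 <= x -> 1 + n%:R * x <= (1 + x) ^+ n.
Proof.
move=> x0; elim: n => [|n ih]; first by rewrite mul0r addr0 expr0.
have x1 : 0 <= 1 + x by rewrite addrC -lerBlDr sub0r.
rewrite exprS; apply: le_trans (ler_wpM2l x1 ih); rewrite -subr_ge0.
rewrite (_ : _ - _ = n%:R * x ^+ 2) ?(mulr_ge0 _ (sqr_ge0 _)) //.
by rewrite -natr1; ring.
Qed.

(** The ratio is the product of js / (js+1) for 1 <= j <= q, and Bernoulli's
    inequality (1 + 1/(js))^s >= 1 + 1/j makes its s-th power telescope. *)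
Lemma rising_ratio q s : (0 < s)%N ->
  (rising q s%:R s%:R / rising q s%:R s.+1%:R) ^+ s * q.+1%:R <= 1 :> R.
Proof.
move=> s0; elim: q => [|q ih]; first by rewrite /rising !big_ord0 divr1 expr1n mulr1.
have rp k : 0 < rising q s%:R k.+1%:R :> R by apply: rising_gt0.
rewrite /rising !big_ord_recr /= -/(rising _ _ _) -/(rising _ _ _).
rewrite -mulf_div exprMn.
set a := (rising _ _ _ / _) ^+ s; set b := _ ^+ s.
have a0 : 0 <= a by rewrite exprn_ge0 ?divr_ge0 ?rising_ge0.
apply: le_trans ih; rewrite -mulrA ler_wpM2l //.
have s0' : (0 : R) < s%:R by rewrite ltr0n.
have u0 : (0 : R) < s%:R + q%:R * s%:R by rewrite ltr_wpDr ?mulr_ge0.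
have v0 : (0 : R) < s.+1%:R + q%:R * s%:R by rewrite ltr_wpDr ?mulr_ge0.
rewrite /b expr_div_n mulrAC ler_pdivrMr ?exprn_gt0 //.
have -> : s.+1%:R + q%:R * s%:R = (s%:R + q%:R * s%:R) * (1 + (s%:R + q%:R * s%:R)^-1) :> R.
  rewrite -natr1; field; exact: lt0r_neq0.
rewrite exprMn [leRHS]mulrCA ler_wpM2l ?exprn_ge0 ?(ltW u0) //.
have h : 1 + s%:R * (s%:R + q%:R * s%:R)^-1 <= (1 + (s%:R + q%:R * s%:R)^-1) ^+ s :> R.
  by apply: one_plus_mul_le_exp; rewrite (le_trans (lerN10 _)) // invr_ge0 ltW.
apply: le_trans (ler_wpM2l (ler0n R q.+1) h).
rewrite le_eqVlt; apply/orP; left; apply/eqP.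
by rewrite -!natr1; field; exact: lt0r_neq0.
Qed.
End Inequalities.

(** * The moment recursion *)

Section Moments.
Variables (R : realFieldType) (d : nat) (d_gt1 : (1 < d)%N).
Implicit Types (tau : tree d) (v : vertex d) (i j : 'I_d).

Let d_gt0 : (0 < d)%N := ltnW d_gt1.
Let s := d.-1.
Let s_gt0 : (0 < s)%N. Proof. by rewrite /s; lia. Qed.
Let dE : d = s.+1. Proof. by rewrite /s; lia. Qed.

Definition outside i0 (x : 'I_d -> nat) : nat := (\sum_(i | i != i0) x i)%N.

Lemma outside_bump_profile i0 (x : 'I_d -> nat) j :
  outside i0 (bump_profile x j) = (outside i0 x + (j != i0) * s)%N.
Proof.
rewrite /outside /bump_profile; have [->|ji] := eqVneq j i0.
  by rewrite addn0; apply: eq_bigr => i /negbTE ->.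
rewrite (bigD1 j) //= eqxx [in RHS](bigD1 j) //= mul1n addnAC; congr (_ + _ + _)%N.
by apply: eq_bigr => i /andP[_ /negbTE ->].
Qed.

(** In the urn, the ratio of the rising factorial of the content outside
    branch i0 to that of the total content is a martingale, and the total is
    deterministic. *)
Lemma expect_rising n q i0 tau : branching tau ->
  expect n (fun t => rising q s%:R (outside i0 (profile t))%:R) tau =
  rising q s%:R (outside i0 (profile tau))%:R / rising q s%:R #|` leaves tau|%:R
    * rising q s%:R (#|` leaves tau| + n * s)%:R :> R.
Proof.
elim: n tau => [|n ih] tau bt.
all: have [ct rt pt] := bt.
all: have Lx := card_leaves_profile bt.
all: have L0 : (0 < #|` leaves tau|)%N by
  rewrite Lx (bigD1 (Ordinal d_gt0)) //= addn_gt0 pt.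
all: have L0' : 0 < #|` leaves tau|%:R :> R by rewrite ltr0n.
  rewrite /= mul0n addn0 divfK //; apply: lt0r_neq0; exact: rising_gt0.
rewrite expectS average_branching //.
set L := #|` leaves tau| in Lx L0 L0' *; set a := outside i0 (profile tau).
have [Ls0] : 0 < rising q s%:R (L%:R + s%:R) :> R by apply: rising_gt0; rewrite ?addr_gt0 ?ltr0n.
have step j v : v \in leaves (branch tau j) ->
    expect n (fun t => rising q s%:R (outside i0 (profile t))%:R) (give_birth tau (j :: v)) =
    rising q s%:R (a + (j != i0) * s)%:R / rising q s%:R (L%:R + s%:R) *
    rising q s%:R (L + n.+1 * s)%:R :> R.
  move=> vl; have vl' := vl; rewrite mem_leaves_branch in vl'.
  rewrite ih; last exact: branching_give_birth.
  rewrite card_leaves_give_birth // profile_give_birth // outside_bump_profile.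
  by rewrite -/L -/s (natrD R L s) mulSn addnA.
rewrite (eq_bigr (fun j => (profile tau j)%:R * (rising q s%:R (a + (j != i0) * s)%:R /
    rising q s%:R (L%:R + s%:R) * rising q s%:R (L + n.+1 * s)%:R))); last first.
  move=> j _; rewrite (eq_big_seq _ (step j)) big_const_seq count_predT iter_addr_0.
  by rewrite -[LHS]mulr_natl.
(* A birth in branch i0 leaves x_A unchanged; any other one adds s to it. *)
rewrite -Lx (bigD1 i0) //= eqxx addn0.
under eq_bigr => j -> do rewrite mul1n.
rewrite -mulr_suml -natr_sum -/(outside _ _) -/a.
have La : (profile tau i0)%:R = L%:R - a%:R :> R.
  by rewrite Lx (bigD1 i0) //= natrD addrK.
rewrite La (natrD R a); set Q := rising _ _ (L + _)%:R.
have sh := rising_shift q s%:R (a%:R : R).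
have sh' := rising_shift q s%:R (L%:R : R).
have Lq : 0 < rising q s%:R L%:R :> R by apply: rising_gt0.
have -> : rising q s%:R (L%:R + s%:R) = (L%:R + q%:R * s%:R) * rising q s%:R L%:R / L%:R :> R.
  by rewrite -sh' mulrC mulKf // lt0r_neq0.
rewrite [a%:R * (_ * Q)]mulrA [a%:R * (_ / _)]mulrA sh.
field; rewrite !lt0r_neq0 //.
by rewrite ltr_wpDr ?mulr_ge0.
Qed.

Definition moment q n : R :=
  expect n (fun t => (largest_rary_subtree_size s t)%:R ^+ q.+1) (root_tree d).

(** The maximum over the missed child i0 is bounded by the sum over i0; the
    weights in the convexity inequality are the leaf counts. *)
Lemma largest_power_le q tau : branching tau ->
  (largest_rary_subtree_size s tau)%:R ^+ q.+1 <=
  \sum_i0 ((1 + (outside i0 (profile tau))%:R) ^+ q +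
    \sum_(i | i != i0) (1 + (outside i0 (profile tau))%:R) ^+ q / (profile tau i)%:R ^+ q
       * (largest_rary_subtree_size s (branch tau i))%:R ^+ q.+1) :> R.
Proof.
move=> [_ _ pt]; have := largest_rary_subtree_size_branches tau d_gt1; rewrite -/s.
set F := BIG_F.
have cd : (0 < #|'I_d|)%N by rewrite card_ord.
have [i0 ->] := bigop.eq_bigmax F cd.
move=> h; rewrite (bigD1 i0) //= -[leLHS]addr0 lerD //; last first.
  apply: sumr_ge0 => i _; rewrite addr_ge0 ?exprn_ge0 ?addr_ge0 //.
  by apply: sumr_ge0 => j _; rewrite !mulr_ge0 ?invr_ge0 ?exprn_ge0 ?addr_ge0.
apply: le_trans (_ : (F i0)%:R ^+ q.+1 <= _); first by rewrite lerXn2r ?nnegrE ?ler_nat.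
rewrite /F natrD natr_sum.
apply: le_trans (@power_sum_le _ _ _ _ _ (fun i => (profile tau i)%:R) _ _) _ => //.
  by move=> j _; rewrite ltr0n.
rewrite -natr_sum -/(outside _ _) mulrDr mulr1 lerD2l mulr_sumr.
by apply: ler_sum => i _; rewrite mulrA [X in X <= _]mulrAC.
Qed.

Lemma card_leaves_star : #|` leaves (star d)| = d.
Proof.
rewrite (card_leaves_profile (branching_star d_gt0)) /profile.
rewrite (eq_bigr (fun=> 1%N)) ?sum1_card ?card_ord // => i _.
by rewrite branch_star leaves_root_tree cardfs1.
Qed.

Lemma outside_profile_star i0 : outside i0 (profile (star d)) = s.
Proof.
rewrite /outside (eq_bigr (fun=> 1%N)) => [|i _]; last first.
  by rewrite /profile branch_star leaves_root_tree cardfs1.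
by rewrite sum1_card cardC1 card_ord.
Qed.

Lemma expect_outside_power_le q n i0 : (0 < q)%N ->
  expect n (fun t => (1 + (outside i0 (profile t))%:R) ^+ q) (star d) <=
  d%:R / s%:R * (rising q s%:R s%:R / rising q s%:R d%:R * rising q s%:R (d + n * s)%:R) :> R.
Proof.
move=> q0; have := expect_rising n q i0 (branching_star d_gt0).
rewrite card_leaves_star outside_profile_star => <-; rewrite -expectZ.
apply: (@expect_le _ _ (@branching d)); [exact: branching_give_birth | | exact: branching_star].
move=> t [_ _ pt]; set x := outside _ _.
have sx : (s <= x)%N.
  rewrite /x /outside -[s](card_ord s) -[X in (X <= _)%N](_ : (\sum_(i | i != i0) 1 = _)%N).
    by apply: leq_sum => i _; exact: pt.
  by rewrite sum1_card cardC1 !card_ord.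
have x0 : 0 < x%:R :> R by rewrite ltr0n (leq_trans s_gt0).
have s0 : 0 < s%:R :> R by rewrite ltr0n.
have := @power_le_rising R q s%:R x%:R q0; rewrite ler1n s_gt0 => /(_ isT (ltW x0)).
move=> h.
rewrite -(ler_pM2l x0); apply: le_trans h _.
rewrite !mulrA ler_wpM2r ?rising_ge0 //.
rewrite ler_pdivlMr // dE -natr1 -/s.
have : s%:R <= x%:R :> R by rewrite ler_nat.
nra.
Qed.

(** If moments up to time n are at most C (leaves)^q, then each of the d
    choices of i0 contributes (1 + s C) E[(1 + x_A)^q]; together with the loss d / s
    of [power_le_rising] the constant becomes d^2 kappa (1/s + C). *)
Lemma moment_step C q n : 0 <= C -> (0 < q)%N ->
    (forall m, (m <= n)%N -> moment q m <= C * (1 + m * s)%:R ^+ q) ->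
  moment q n.+1 <= d%:R ^+ 2 * (rising q s%:R s%:R / rising q s%:R d%:R) *
    (s%:R^-1 + C) * rising q s%:R (1 + n.+1 * s)%:R.
Proof.
move=> C0 q0 h; rewrite /moment expectS average_root.
pose X i0 t : R := (1 + (outside i0 (profile t))%:R) ^+ q.
have bs := branching_star d_gt0.
apply: le_trans (_ : \sum_i0 (1 + s%:R * C) * expect n (X i0) (star d) <= _).
  apply: le_trans (@expect_le _ _ (@branching d) n _ _ _ (@branching_give_birth _ d_gt0)
    (@largest_power_le q) bs) _.
  rewrite expect_sum; apply: ler_sum => i0 _; rewrite expectD expect_sum mulrDl mul1r lerD //.
  have -> : s%:R * C * expect n (X i0) (star d) =
      \sum_(i | i != i0) C * expect n (X i0) (star d).
    by rewrite sumr_const cardC1 card_ord -mulrA mulr_natl.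
  apply: ler_sum => i _.
  pose psi (x : 'I_d -> nat) : R := (1 + (outside i0 x)%:R) ^+ q / (x i)%:R ^+ q.
  have psi0 x : 0 <= psi x by rewrite !mulr_ge0 ?invr_ge0 ?exprn_ge0 ?addr_ge0.
  have hC m : (m <= n)%N ->
      expect m (fun t => (largest_rary_subtree_size s t)%:R ^+ q.+1) (root_tree d) <=
      expect m (fun t => C * #|` leaves t|%:R ^+ q : R) (root_tree d).
    move=> mn; rewrite (expect_card_leaves d_gt0 (fun k => C * k%:R ^+ q)).
    + by rewrite leaves_root_tree cardfs1; exact: h.
    + exact: prefix_closed_root_tree.
    + by rewrite leaves_root_tree cardfs1.
  apply: le_trans (expect_profile_branch_le d_gt0 i hC psi0) _.
  rewrite -expectZ; apply: (@expect_le _ _ (@branching d)) => //.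
    exact: branching_give_birth.
  move=> t [_ _ pt]; rewrite /psi -/(profile t i) mulrCA divfK //.
  by rewrite expf_neq0 // pnatr_eq0 -lt0n pt.
have C1 : 0 <= 1 + s%:R * C by rewrite addr_ge0 ?mulr_ge0.
apply: le_trans (ler_sum _ (fun i0 _ => ler_wpM2l C1 (expect_outside_power_le n i0 q0))) _.
rewrite sumr_const card_ord -[leLHS]mulr_natl mulSn addnA add1n -dE.
have s0 : s%:R != 0 :> R by rewrite pnatr_eq0 -lt0n.
rewrite le_eqVlt; apply/orP; left; apply/eqP.
by rewrite [_ / rising _ _ _]mulrC; set k := _^-1 * rising _ _ s%:R; field.
Qed.
End Moments.

(** * Growth of the moments *)

Section MomentBound.
Variables (R : realType) (d : nat) (d_gt1 : (1 < d)%N).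
Let s := d.-1.
Let q := (d ^ (2 * s))%N.
Let s_gt0 : (0 < s)%N. Proof. by rewrite /s; lia. Qed.
Let dE : d = s.+1. Proof. by rewrite /s; lia. Qed.
Let q_gt0 : (0 < q)%N. Proof. by rewrite /q expn_gt0 dE. Qed.

(** The s-th power of the left-hand side is at most d^(2s) / (q+1), which is
    why q is taken to be d^(2s). *)
Lemma urn_rate_lt1 : d%:R ^+ 2 * (rising q s%:R s%:R / rising q s%:R d%:R) < 1 :> R.
Proof.
set k := rising _ _ _ / _; have k0 : 0 <= k by rewrite divr_ge0 ?rising_ge0.
have ks : k ^+ s * q.+1%:R <= 1 by have := @rising_ratio R q s s_gt0; rewrite -dE.
rewrite ltNge; apply/negP => h.
have : 1 <= (d%:R ^+ 2 * k) ^+ s by rewrite exprn_ege1.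
rewrite exprMn -exprM -natrX -/q => h'.
have ks0 : 0 < k ^+ s.
  rewrite lt0r exprn_ge0 // andbT; apply: contraTneq h' => ->.
  by rewrite mulr0 -ltNge ltr01.
move: ks; rewrite -natr1 => ks; nra.
Qed.

Lemma moment_ge0 k n : 0 <= moment R d k n.
Proof.
rewrite /moment; have {1}-> : 0 = expect n (fun=> 0 : R) (root_tree d).
  by elim: n (root_tree d) => // n ih t; rewrite expectS /average big1 ?mulr0.
by apply: (@expect_le _ _ (fun=> True)) => // t _; rewrite exprn_ge0.
Qed.

(** The recursion [moment_step] contracts by a factor rho < 1 up to the
    additive constant and the discrepancy between the rising factorial
    and the power, both negligible once the tree and C are large; C is chosen
    large enough to cover the finitely many small trees. *)
Lemma moment_bound : exists2 C : R, 0 <= C &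
  forall n, moment R d q n <= C * (1 + n * s)%:R ^+ q.
Proof.
set rho := d%:R ^+ 2 * (rising q s%:R s%:R / rising q s%:R d%:R) : R.
have rho1 : rho < 1 by exact: urn_rate_lt1.
have rho0 : 0 <= rho by rewrite mulr_ge0 ?exprn_ge0 ?divr_ge0 ?rising_ge0.
pose eps := 1 - rho; have eps0 : 0 < eps by rewrite subr_gt0.
(* Beyond B leaves, l^q >= (1 - eps/2) (l + qs)^q by Bernoulli; half of the
   contraction eps is thus left to absorb the additive term, if C >= 2/eps. *)
pose B := 2 * q%:R * (q%:R * s%:R) / eps.
have B0 : 0 <= B by rewrite divr_ge0 ?mulr_ge0 // ltW.
pose M := Num.bound B.
pose C := 2 / eps + \sum_(n < M) moment R d q n.
have sum0 : 0 <= \sum_(n < M) moment R d q n by apply: sumr_ge0 => i _; exact: moment_ge0.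
have Ceps : 2 / eps <= C by rewrite lerDl.
have C0 : 0 <= C by rewrite (le_trans _ Ceps) // divr_ge0 // ltW.
exists C => // n; elim/ltn_ind: n => n ih.
have [nM|Mn] := ltnP n M.
  apply: le_trans (_ : C * 1 <= _); last first.
    by rewrite ler_wpM2l // exprn_ege1 // ler1n.
  rewrite mulr1 /C (bigD1 (Ordinal nM)) //= addrCA lerDl addr_ge0 ?divr_ge0 ?(ltW eps0) //.
  by apply: sumr_ge0 => i _; exact: moment_ge0.
case: n ih Mn => [|n] ih Mn.
  have := archi_boundP B0; rewrite -/M; move: Mn.
  by rewrite leqn0 => /eqP -> /(le_lt_trans B0); rewrite ltxx.
apply: le_trans (moment_step d_gt1 C0 q_gt0 _) _ => [m mn|]; first exact: ih.
rewrite -/s -/rho; set l := (1 + n.+1 * s)%:R.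
have l0 : 0 < l by rewrite ltr0n.
have lB : B < l.
  apply: lt_le_trans (archi_boundP B0) _; rewrite ler_nat -/M.
  by apply: leq_trans Mn _; nia.
have qs0 : 0 < q%:R * s%:R :> R by rewrite mulr_gt0 ?ltr0n.
have Z0 : 0 <= (l + q%:R * s%:R) ^+ q by rewrite exprn_ge0 // addr_ge0 ?ltW.
have D0 : 0 < l + q%:R * s%:R by rewrite addr_gt0.
have lZ : (1 - eps / 2) * (l + q%:R * s%:R) ^+ q <= l ^+ q.
  have := @one_plus_mul_le_exp R q (- (q%:R * s%:R / (l + q%:R * s%:R))).
  rewrite lerN2 ler_pdivrMr // mul1r lerDr (ltW l0) => /(_ isT).
  have -> : 1 - q%:R * s%:R / (l + q%:R * s%:R) = l / (l + q%:R * s%:R).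
    by field; exact: lt0r_neq0.
  rewrite expr_div_n ler_pdivlMr ?exprn_gt0 //; apply: le_trans.
  rewrite ler_wpM2r // lerD2l mulrN lerN2 mulrA ler_pdivrMr //.
  move: lB; rewrite /B ltr_pdivrMr // => lB; nra.
have s1 : s%:R^-1 <= 1 :> R by rewrite invf_le1 ?ltr0n // ler1n.
have K0 : 0 <= rho * (s%:R^-1 + C) by rewrite mulr_ge0 // addr_ge0 ?invr_ge0.
apply: le_trans (ler_wpM2l K0 (rising_le q (ler0n R s) (ltW l0))) _.
apply: le_trans (ler_wpM2l C0 lZ); rewrite mulrA ler_wpM2r //.
move: Ceps; rewrite ler_pdivrMr // => Ceps.
have rE : rho = 1 - eps by rewrite /eps subKr.
have : rho * s%:R^-1 <= 1 by rewrite mulr_ile1 ?invr_ge0 // ltW.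
rewrite mulrDr rE; nra.
Qed.
End MomentBound.

(** * Comparison with the exponent delta *)

(** Here 1 - delta is at most (d-1) / d^(2d), because e ln(11 d ln d) >= 1,
    whereas q d^2 = d^(2d) makes 1/(q+1) about d^2 / d^(2d). *)
Lemma moment_exponent_lt_delta (R : realType) (d r : nat) : (0 < r)%N -> (r < d)%N ->
  (d ^ (2 * d.-1))%:R < delta R d r * (d ^ (2 * d.-1)).+1%:R :> R.
Proof.
move=> r0 rd; set q := (d ^ _)%N.
have d2 : (2 <= d)%N by lia.
have e2 : 2 <= expR 1 :> R by have := expR_ge1Dx (1 : R); lra.
have ln2 : 2^-1 <= ln 2 :> R.
  have := @le_ln1Dx R (- 2^-1); rewrite (_ : 1 + - 2^-1 = 2^-1); last by field.
  by rewrite lnV ?posrE // => /(_ _); lra.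
have d2R : 2 <= d%:R :> R by rewrite ler_nat.
have lnd : 2^-1 <= ln d%:R :> R.
  by apply: le_trans ln2 _; rewrite ler_ln ?posrE // ltr0n; lia.
have lnK : 2^-1 <= ln (11%:R * d%:R * ln d%:R) :> R.
  have : 11 <= 11%:R * d%:R * ln d%:R :> R by nra.
  by move=> h; apply: le_trans ln2 _; rewrite ler_ln ?posrE //; lra.
rewrite /delta; set D := (expR 1 * _ * _ : R).
have qD : (q * d ^ 2 = d ^ (2 * d))%N by rewrite /q -expnD; congr (_ ^ _)%N; lia.
have q0 : (0 < q)%N by rewrite expn_gt0; lia.
have D0 : (d ^ (2 * d))%:R <= D.
  have : 1 <= expR 1 * ln (11%:R * d%:R * ln d%:R) :> R by nra.
  by move=> h1; rewrite /D natrX mulrAC; apply: ler_peMl => [|//]; exact: exprn_ge0.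
have : ((d - r) * q.+1)%:R < D.
  apply: lt_le_trans D0.
  rewrite ltr_nat -qD.
  apply: leq_ltn_trans (_ : d.-1 * (2 * q) < _)%N; first by apply: leq_mul; lia.
  by rewrite mulnA mulnC ltn_pmul2l // expnS expn1; nia.
rewrite natrM natrB ?(ltnW rd) // => h.
have Dp : 0 < D by apply: lt_le_trans D0; rewrite ltr0n expn_gt0; lia.
rewrite mulrBl mul1r -[X in X < _](addrK 1) natr1 ltrD2l ltrN2.
by rewrite mulrAC ltr_pdivrMr // mul1r.
Qed.

(** * The law of the process *)

Section Law.
Context (R : realType) (disp : measure_display) (Omega : measurableType disp).
Variables (P : probability Omega R) (d : nat) (d_gt0 : (0 < d)%N).
Variables (chosen : nat -> Omega -> vertex d) (T : nat -> Omega -> tree d).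
Hypothesis process_T : recursive_tree_process P chosen T.

Lemma measurable_tree_event (B : tree d -> Prop) t :
  measurable [set w | B (T t w)].
Proof.
elim: t B => [|t ih] B.
  have [b|nb] := pselect (B (root_tree d)).
    rewrite (_ : [set _ | _] = setT) //; apply/seteqP; split=> w //= _.
    by rewrite (process_start process_T).
  rewrite (_ : [set _ | _] = set0) //; apply/seteqP; split=> w //=.
  by rewrite (process_start process_T).
rewrite (_ : [set _ | _] = \bigcup_(v : vertex d)
    ([set w | chosen t w = v] `&` [set w | B (give_birth (T t w) v)])).
  apply: countable_bigcupT_measurable; first exact: (countableP [set: seq 'I_d]).
  move=> v; apply: measurableI; first exact: (chosen_measurable process_T).
  exact: (ih (fun tau => B (give_birth tau v))).
apply/seteqP; split => [w|w [v _]] /=; rewrite (process_step process_T).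
  by move=> Bw; exists (chosen t w).
by move=> [-> ].
Qed.

(** Knowing the tree after a step tells which leaf gave birth, so a past of
    the tree is also a past of the choices. *)
Lemma give_birth_inj (tau : tree d) u v : u \in leaves tau -> v \in leaves tau ->
  give_birth tau u = give_birth tau v -> u = v.
Proof.
rewrite !in_leaves => /andP[_ /forallP ul] _ uv.
have := in_give_birth tau v (rcons u (Ordinal d_gt0)).
rewrite -uv in_give_birth (negbTE (ul _)) /=.
have -> : [exists i, rcons u (Ordinal d_gt0) == rcons u i] by apply/existsP; exists (Ordinal d_gt0).
by move=> /esym/existsP[i]; rewrite eqseq_rcons => /andP[/eqP].
Qed.

Definition past s (h : nat -> tree d) : set Omega :=
  [set w | forall k, (k <= s)%N -> T k w = h k].

Lemma measurable_past s h : measurable (past s h).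
Proof.
rewrite (_ : past s h = \bigcap_(k in [set k | (k <= s)%N]) [set w | T k w = h k]).
  apply: bigcap_measurable => [|k _]; first by exists 0%N.
  exact: (measurable_tree_event (fun tau => tau = h k)).
by apply/seteqP; split=> w.
Qed.

(** The Markov property.  The past up to s splits according to the leaf chosen
    next; each piece is again a past, of length s + 1, and has the conditional
    probability prescribed by the uniform rule. *)
Lemma past_law n s h (B : pred (tree d)) :
  P (past s h `&` [set w | B (T (s + n)%N w)]) =
  ((expect n (fun t => (B t)%:R) (h s))%:E * P (past s h))%E.
Proof.
elim: n s h => [|n ih] s h.
  rewrite addn0 /=; case Bh : (B (h s)).
    rewrite mul1e; congr (P _); apply/seteqP; split=> [w []//|w /= pw]; split=> //.
    by rewrite /= (pw s) ?leqnn // Bh.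
  rewrite mul0e -(measure0 P); congr (P _); apply/seteqP; split=> w //= [pw].
  by rewrite (pw s) ?leqnn // Bh.
(* The past s h prolonged by the birth at v. *)
pose hv v k := if (k <= s)%N then h k else give_birth (h s) v.
have hvE v : v \in leaves (h s) ->
    past s.+1 (hv v) = past s h `&` [set w | chosen s w = v].
  move=> vl; apply/seteqP; split=> [w pw|w [pw cw] k].
    have pw' : past s h w.
      by move=> k ks; rewrite (pw k) ?(leqW ks) // /hv ks.
    split=> //=; apply: (@give_birth_inj (h s)) => //.
      by rewrite -(pw' s) ?leqnn //; exact: (chosen_leaf process_T).
    by have := pw s.+1 (leqnn _); rewrite (process_step process_T) (pw' s) ?leqnn // /hv ltnn.
  rewrite leq_eqVlt => /orP[/eqP ->|ks]; last by rewrite ltnS in ks; rewrite /hv ks; exact: pw.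
  by rewrite (process_step process_T) /hv ltnn (pw s) ?leqnn // cw.
have -> : past s h `&` [set w | B (T (s + n.+1)%N w)] =
    \bigcup_(v in [set` leaves (h s)])
      (past s.+1 (hv v) `&` [set w | B (T (s.+1 + n)%N w)]).
  rewrite addSnnS; apply/seteqP; split=> [w [pw Bw]|w [v /= vl]].
    have cl : chosen s w \in leaves (h s).
      by rewrite -(pw s) ?leqnn //; exact: (chosen_leaf process_T).
    by exists (chosen s w) => //; split => //; rewrite hvE.
  by rewrite hvE // => -[[]].
rewrite bigcup_fset measure_fbigsetU; last 2 first.
- move=> v _; apply: measurableI; first exact: measurable_past.
  exact: (measurable_tree_event (fun t => B t)).
- move=> u v /= ul vl [w [[]]]; rewrite !hvE // => -[_ /= <-] _ [[_ /= <-]] _.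
  by [].
rewrite expectS /average big_seq.
rewrite (eq_bigr (fun v => (expect n (fun t => (B t)%:R) (give_birth (h s) v) *
    #|` leaves (h s)|%:R^-1)%:E * P (past s h))%E); last first.
  move=> v vl; apply: etrans (ih _ _) _; rewrite hvE // (chosen_uniform process_T) // muleA -EFinM.
  by rewrite {1}/hv ltnn.
rewrite -big_seq -ge0_sume_distrl.
  by rewrite sumEFin -mulr_suml mulrC.
move=> v _; rewrite lee_fin mulr_ge0 ?invr_ge0 //.
rewrite -[leLHS](_ : expect n (fun=> 0) (give_birth (h s) v) = 0).
  by apply: (@expect_le _ _ (fun=> True)).
by elim: n {ih} (give_birth _ _) => // n ih t; rewrite expectS /average big1 ?mulr0.
Qed.

Lemma tree_law t (B : pred (tree d)) :
  P [set w | B (T t w)] = (expect t (fun tau => (B tau)%:R) (root_tree d))%:E.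
Proof.
have := past_law t 0 (fun=> root_tree d) B.
have -> : past 0 (fun=> root_tree d) = setT.
  by apply/seteqP; split=> w // _ k; rewrite leqn0 => /eqP ->; exact: (process_start process_T).
by rewrite setTI probability_setT mule1.
Qed.

Lemma tree_markov t (F : tree d -> R) x : 0 < x -> (forall tau, 0 <= F tau) ->
  (P [set w | (x <= F (T t w))%R] <= (expect t F (root_tree d) / x)%:E)%E.
Proof.
move=> x0 F0; rewrite (tree_law t (fun tau => x <= F tau)) lee_fin.
rewrite mulrC -expectZ; apply: (@expect_le _ _ (fun=> True)) => // tau _.
rewrite -(ler_pM2l x0) mulrA divff ?mul1r ?lt0r_neq0 //.
by case: (boolP (x <= F tau)) => h; rewrite ?mulr1 ?mulr0.
Qed.
End Law.

(** * From summable probabilities to eventual occurrence *)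

Section Eventually.
Context (R : realType) (disp : measure_display) (Omega : measurableType disp).
Variable P : probability Omega R.

Lemma geometric_summable (u : nat -> \bar R) (a z : R) :
    0 <= a -> 0 <= z -> z < 1 ->
    (forall k, (0 <= u k)%E) -> (forall k, (u k <= (a * z ^+ k)%:E)%E) ->
  (\sum_(0 <= k <oo) u k < +oo)%E.
Proof.
move=> a0 z0 z1 u0 ua; apply: (@le_lt_trans _ _ (a / (1 - z))%:E); last exact: ltry.
apply: lime_le; first exact: is_cvg_nneseries.
apply: nearW => n; apply: le_trans (lee_sum _ (fun k _ => ua k)) _.
rewrite sumEFin lee_fin -mulr_sumr ler_wpM2l //.
rewrite -[leRHS]mul1r ler_pdivlMr ?subr_gt0 //.
elim: n => [|n ih]; first by rewrite big_nil mul0r.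
have -> : \sum_(0 <= i < n.+1) z ^+ i = 1 + z * \sum_(0 <= i < n) z ^+ i.
  rewrite big_nat_recl // expr0 mulr_sumr; congr (_ + _).
  by apply: eq_bigr => i _; rewrite exprS.
have := ler_wpM2l z0 ih; nra.
Qed.

(** Each failure of A at a time k is charged to a bad event D j with a j > k.
    The random time 1 + sum of (a j) 1_(D j) is measurable, exceeds every such
    a j, and is finite outside the limit superior of the D j, which is
    negligible by Borel-Cantelli.  The term 1 excludes the time k = 0. *)
Lemma occurs_eventually_of_summable (D : nat -> set Omega) (a : nat -> nat)
    (A : nat -> set Omega) :
    (forall j, measurable (D j)) -> (\sum_(0 <= j <oo) P (D j) < +oo)%E ->
    (forall w k, (0 < k)%N -> ~ A k w -> exists2 j, D j w & (k < a j)%N) ->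
  occurs_eventually P A.
Proof.
move=> mD sD DA.
pose u j w : \bar R := ((a j)%:R * \1_(D j) w)%:E.
have u0 j w : (0 <= u j w)%E by rewrite lee_fin mulr_ge0.
pose N w : \bar R := (1 + \sum_(0 <= j <oo) u j w)%E.
have mN : measurable_fun setT N.
  apply: emeasurable_funD; first exact: measurable_cst.
  apply: ge0_emeasurable_sum => [k x _ _|k _]; first exact: u0.
  apply/measurable_EFinP; apply: measurable_funM; first exact: measurable_cst.
  exact: measurable_indic.
pose N' : {mfun Omega >-> \bar R} := mfun_Sub (mem_set mN).
exists N'; split; last first.
  move=> w k; change (N' w) with (N w) => Nk; apply: contrapT => nA.
  have S0 : (0 <= \sum_(0 <= j <oo) u j w)%E by apply: nneseries_ge0.
  have k0 : (0 < k)%N.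
    rewrite lt0n; apply/eqP => k0; move: Nk; rewrite k0 /N leNgt => /negP; apply.
    by apply: (@lt_le_trans _ _ 1%E); [rewrite lte_fin ltr01|rewrite leeDl].
  have [j Dj kj] := DA w k k0 nA.
  have : (u j w <= N w)%E.
    rewrite /N; apply: le_trans (leeDr _ _) => //.
    apply: le_trans (nneseries_lim_ge j.+1 _) => //.
    by rewrite big_nat_recr //= leeDr // sume_ge0.
  rewrite /u indicE mem_set // mulr1 => /le_trans/(_ Nk).
  by rewrite lee_fin ler_nat leqNgt kj.
exists (lim_sup_set D); split.
- by apply: bigcap_measurable => // n _; apply: bigcup_measurable => k _; exact: mD.
- exact: lim_sup_set_cvg0.
move=> w /= hN n _; apply: contrapT => hn; apply: hN.
change (N' w) with (N w).
rewrite /N (nneseries_split 0 n) // eseries0 => [|i ni _]; last first.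
  rewrite /u indicE memNset ?mulr0 // => Di; apply: hn; exists i => //=.
by rewrite adde0 add0n /u sumEFin -EFinD.
Qed.
End Eventually.

(** * Largest r-ary subtrees *)

Lemma give_birth_sub (d : nat) (tau : tree d) v : (tau `<=` give_birth tau v)%fset.
Proof. by apply/fsubsetP => u; rewrite in_give_birth => ->. Qed.

Theorem theorem5p1 (R : realType) (disp : measure_display)
    (Omega : measurableType disp) (P : probability Omega R)
    (r d : nat) (r_gt0 : (0 < r)%N) (r_lt_d : (r < d)%N)
    (chosen : nat -> Omega -> vertex d) (T : nat -> Omega -> tree d)
    (process_T : recursive_tree_process P chosen T) :
  occurs_eventually P (fun t =>
    [set w | (largest_rary_subtree_size r (T t w))%:R < (t%:R : R) `^ delta R d r]).
Proof.
have d_gt1 : (1 < d)%N by lia.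
have d_gt0 : (0 < d)%N by lia.
pose s := d.-1; pose q := (d ^ (2 * s))%N.
have [C C0 CP] := moment_bound R d_gt1; rewrite -/s -/q in CP.
pose del := delta R d r.
(* The gain over Markov's inequality: t^(delta (q+1)) = t^q t^eta. *)
pose eta := del * q.+1%:R - q%:R.
have eta0 : 0 < eta by rewrite subr_gt0; exact: moment_exponent_lt_delta.
have del0 : 0 <= del.
  rewrite -(pmulr_lge0 _ (ltr0Sn R q));
  apply: le_trans (ltW (moment_exponent_lt_delta R r_gt0 r_lt_d)).
  exact: ler0n.
pose W (tau : tree d) : R := (largest_rary_subtree_size s tau)%:R.
(* If W(T_k) >= k^delta with 2^j <= k < 2^(j+1), then D j occurs, since W grows
   with time. *)
pose D k := [set w | (2 ^ k)%N%:R `^ del <= W (T (2 ^ k.+1)%N w)].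
pose z := (2 `^ eta)^-1 : R.
have z_gt0 : 0 < 2 `^ eta :> R by exact: powR_gt0.
have z0 : 0 <= z by rewrite invr_ge0 ltW.
have z1 : z < 1.
  have := @gt0_ltr_powR R eta eta0 1 2; rewrite !nnegrE powR1 invf_lt1 //.
  by apply => //; rewrite ltr1n.
have PD k : (P (D k) <= (C * (1 + 2 * s)%:R ^+ q * z ^+ k)%:E)%E.
  set x : R := (2 ^ k)%N%:R `^ del.
  have b0 : 0 < (2 ^ k)%N%:R :> R by rewrite ltr0n expn_gt0.
  have x0 : 0 < x by exact: powR_gt0.
  have xp : x ^+ q.+1 = (2 ^ k)%N%:R ^+ q * (2 `^ eta) ^+ k.
    rewrite /x -powR_mulrn ?powR_ge0 // -powRrM.
    have -> : del * q.+1%:R = q%:R + eta by rewrite /eta addrC subrK.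
    rewrite powRD ?(gt_eqF b0) ?implybT // powR_mulrn ?ltW //; congr (_ * _).
    by rewrite natrX -powR_mulrn // -powRrM mulrC powRrM powR_mulrn ?powR_ge0.
  have -> : D k = [set w | x ^+ q.+1 <= W (T (2 ^ k.+1)%N w) ^+ q.+1].
    by apply/funext => w; rewrite /D /= ler_pXn2r ?nnegrE // ltW.
  apply: le_trans (tree_markov d_gt0 process_T (F := fun t => W t ^+ q.+1) _ _ _) _.
  - by rewrite exprn_gt0.
  - by move=> tau; rewrite exprn_ge0.
  rewrite lee_fin ler_pdivrMr ?exprn_gt0 //; apply: le_trans (CP _) _.
  rewrite xp /z exprVn.
  rewrite [leRHS](_ : _ = C * ((1 + 2 * s)%:R * (2 ^ k)%N%:R) ^+ q); last first.
    by rewrite exprMn; field; rewrite expf_neq0 // lt0r_neq0.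
  rewrite ler_wpM2l // -natrM lerXn2r ?nnegrE // ler_nat expnS mulnDl mul1n leq_add ?expn_gt0 //.
  by rewrite mulnAC.
apply: (@occurs_eventually_of_summable _ _ _ _ D (fun j => 2 ^ j.+1)%N).
- move=> j; exact: (measurable_tree_event process_T
    (fun tau => (2 ^ j)%N%:R `^ del <= W tau)).
- apply: (@geometric_summable _ _ (C * (1 + 2 * s)%:R ^+ q) z) => //.
  by rewrite mulr_ge0 ?exprn_ge0.
move=> w k k0 /= /negP; rewrite -leNgt => kW.
pose j := trunc_log 2 k; have /andP[jk kj] := trunc_log_bounds (ltnSn 1) k0.
exists j => //=; rewrite /D /=.
apply: le_trans (_ : k%:R `^ del <= _).
  by rewrite ge0_ler_powR ?nnegrE // ler_nat.
apply: le_trans kW _; rewrite ler_nat; apply: largest_rary_subtree_size_homo.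
  by rewrite /s; lia.
move: kj; rewrite -/j => /ltnW/subnK <-; elim: (_ - _)%N => [|m ih] //=.
apply: fsubset_trans ih _; rewrite addSn (process_step process_T).
exact: give_birth_sub.
Qed.
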